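(* There exists a regainingly approximable set $A\subseteq\mathbb{N}$ that is Kummer complex, i.e., there is a constant $d\in\mathbb{N}$ such that $C(A\restriction n)\ge 2\log(n)-d$ for infinitely many $n$.
   Context: A real number $\alpha$ is regainingly approximable if there exists a computable nondecreasing sequence of rational numbers $(a_n)_n$ converging to $\alpha$ such that $\alpha-a_n<2^{-n}$ holds for infinitely many $n\in\mathbb{N}$. For $A\subseteq\mathbb{N}$ let $2^{-A}:=\sum_{a\in A}2^{-(a+1)}$; a set $A\subseteq\mathbb{N}$ is regainingly approximable if it is computably enumerable and $2^{-A}$ is regainingly approximable. $C$ denotes plain Kolmogorov complexity; $A\restriction n$ is the string $A(0)\dots A(n-1)$ of the characteristic sequence of $A$. For $n\in\mathbb{N}$, $\log(n)$ denotes the length of the binary representation of $n$ (so $\log(n)=\lfloor\log_2 n\rfloor+1$ for $n>0$ and $\log(0)=1$). *)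

(* Defs.v *)
From HB Require Import structures.
From mathcomp Require Import all_boot all_order all_algebra.
From mathcomp Require Import all_classical all_reals all_analysis.
From Stdlib Require Cantor.

Set Implicit Arguments.
Unset Strict Implicit.
Unset Printing Implicit Defensive.

Import Order.TTheory GRing.Theory Num.Theory.
Import numFieldNormedType.Exports.

Local Open Scope classical_set_scope.

(* Partial recursive functions nat -> nat, generated by zero, successor,
   projections, pairing, composition, primitive recursion and minimization.
   Functions of several arguments are unary functions of Cantor pairs (the same
   presentation as in M. Carneiro, Formalizing computability theory via partial
   recursive functions, ITP 2019). *)

Definition pair_code (x y : nat) : nat := Cantor.to_nat (x, y).

Inductive code : Type :=
| Zero
| Succ
| Fst
| Snd
| Pair of code & code
| Comp of code & code
| Prec of code & code
| Find of code.

(* [eval c x y]: the partial function with program [c] is defined at [x], with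
   value [y]. *)
Inductive eval : code -> nat -> nat -> Prop :=
| eval_zero x : eval Zero x 0
| eval_succ x : eval Succ x x.+1
| eval_fst x y : eval Fst (pair_code x y) x
| eval_snd x y : eval Snd (pair_code x y) y
| eval_pair f g x y z :
    eval f x y -> eval g x z -> eval (Pair f g) x (pair_code y z)
| eval_comp f g x y z :
    eval g x y -> eval f y z -> eval (Comp f g) x z
| eval_prec0 f g a y :
    eval f a y -> eval (Prec f g) (pair_code a 0) y
| eval_precS f g a n y z :
    eval (Prec f g) (pair_code a n) y ->
    eval g (pair_code a (pair_code n y)) z ->
    eval (Prec f g) (pair_code a n.+1) z
  (* least [n] with value 0, all earlier values being defined and nonzero *)
| eval_find f x n (h : nat -> nat) :
    (forall m, (m < n)%N -> eval f (pair_code x m) (h m).+1) ->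
    eval f (pair_code x n) 0 ->
    eval (Find f) x n.

Definition computable_fun (f : nat -> nat) : Prop :=
  exists c : code, forall n, eval c n (f n).

Definition comp_enumerable (A : set nat) : Prop :=
  exists c : code, forall n, A n <-> exists y, eval c n y.

Local Open Scope ring_scope.

Definition computable_rat_seq (a : nat -> rat) : Prop :=
  exists s p q : nat -> nat,
    [/\ computable_fun s, computable_fun p, computable_fun q,
        forall n, (0 < q n)%N &
        forall n, a n = (-1) ^+ s n * ((p n)%:R / (q n)%:R)].

Definition regainingly_approximable (R : realType) (alpha : R) : Prop :=
  exists a : nat -> rat,
    [/\ computable_rat_seq a,
        nondecreasing_seq a,
        (fun n => ratr (a n) : R) @ \oo --> alpha &
        infinite_set [set n : nat | alpha - ratr (a n) < 2 ^- n]].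

Definition set_real (R : realType) (A : set nat) : R :=
  limn (series (fun k : nat => \1_A k * 2 ^- k.+1 : R)).

Definition regainingly_approximable_set (R : realType) (A : set nat) : Prop :=
  comp_enumerable A /\ regainingly_approximable (set_real R A).

(* Bijective base-2 numeration, least significant digit first (false = 1,
   true = 2): an effective bijection between binary strings and nat. *)
Fixpoint string_code (s : seq bool) : nat :=
  if s is b :: s' then (b.+1 + (string_code s').*2)%N else 0%N.

(* [describes U p x]: the machine with program [U], seen as a partial function
   on binary strings, outputs [x] on input [p]. *)
Definition describes (U : code) (p x : seq bool) : Prop :=
  eval U (string_code p) (string_code x).

Definition optimal_machine (U : code) : Prop :=
  forall V : code, exists c : nat, forall p x : seq bool,
    describes V p x ->
    exists2 q : seq bool, describes U q x & (size q <= size p + c)%N.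

(* The least length of a [U]-description of [x]; the default value 0 is never
   used when [U] is optimal, since then every string has a description. *)
Definition plain_complexity (U : code) (x : seq bool) : nat :=
  xget 0%N [set k : nat |
    (exists2 p, size p = k & describes U p x) /\
    (forall p, describes U p x -> (k <= size p)%N)].

Definition restriction (A : set nat) (n : nat) : seq bool :=
  mkseq (fun i => `[< A i >]) n.

(* [trunc_log 2 0 = 0], so this is 1 at 0. *)
Definition binary_length (n : nat) : nat := (trunc_log 2 n).+1.

(* C is plain_complexity U for an optimal U; changing U changes C by at most an
   additive constant, which d absorbs. *)
Definition kummer_complex (A : set nat) : Prop :=
  forall U : code, optimal_machine U ->
  exists d : nat,
    infinite_set [set n : nat |
      (2 * binary_length n <= plain_complexity U (restriction A n) + d)%N].

(* Main.v *)
Require Import Defs.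
From mathcomp Require Import all_boot all_order all_algebra.
From mathcomp Require Import all_classical all_reals all_analysis.
From mathcomp Require Import zify lra.
From Stdlib Require Cantor.

(* Fix an optimal machine. Strategy i owns the interval [2^i, 2^(i+1)); with
   h = 2^i, it adds the next element of its interval to A whenever every string
   A|(2h + r) with r < h is seen to have one of the h^2 shortest programs.
   Programs seen for different r or at different numbers of additions describe
   different strings, so if this went on until the interval is full there would
   be (h + 1) h different programs among h^2; hence some A|(2h + r) has complexity
   at least 2 i, which is 2 log(2h + r) - 4. To make A regainingly approximable,
   an action of strategy i at stage s kills for ever all strategies j with
   i < j <= s. Infinitely many strategies i are never killed, and for such an i
   no smaller strategy acts from stage i on, so that A is settled below 2^i at
   stage i. *)

Set Implicit Arguments.
Unset Strict Implicit.
Unset Printing Implicit Defensive.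

Import Order.TTheory GRing.Theory Num.Theory.
Import numFieldNormedType.Exports.
(* [all_classical] and [all_analysis] shadow [code] and [eval]. *)
Import Defs.

(** * Computable functions *)

Definition unpair1 (z : nat) : nat := (Cantor.of_nat z).1.
Definition unpair2 (z : nat) : nat := (Cantor.of_nat z).2.

Lemma pair_codeK1 x y : unpair1 (pair_code x y) = x.
Proof. by rewrite /unpair1 /pair_code Cantor.cancel_of_to. Qed.

Lemma pair_codeK2 x y : unpair2 (pair_code x y) = y.
Proof. by rewrite /unpair2 /pair_code Cantor.cancel_of_to. Qed.

Lemma unpairK z : pair_code (unpair1 z) (unpair2 z) = z.
Proof.
by rewrite /pair_code /unpair1 /unpair2 -surjective_pairing Cantor.cancel_to_of.
Qed.

Lemma leq_pair_code2 x y : y <= pair_code x y.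
Proof. have := Cantor.to_nat_non_decreasing x y; rewrite /pair_code; lia. Qed.

Lemma eq_computable_fun f g : f =1 g -> computable_fun f -> computable_fun g.
Proof. by move=> fg [c cP]; exists c => n; rewrite -fg. Qed.

Lemma computable_comp f g :
  computable_fun f -> computable_fun g -> computable_fun (fun z => f (g z)).
Proof.
move=> [c cP] [d dP]; exists (Comp c d) => n.
by apply: eval_comp (dP n) (cP _).
Qed.

Lemma computable_unpair1 f :
  computable_fun f -> computable_fun (fun z => unpair1 (f z)).
Proof.
apply: computable_comp; exists Fst => n; rewrite -{1}(unpairK n).
exact: eval_fst.
Qed.

Lemma computable_unpair2 f :
  computable_fun f -> computable_fun (fun z => unpair2 (f z)).
Proof.
apply: computable_comp; exists Snd => n; rewrite -{1}(unpairK n).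
exact: eval_snd.
Qed.

Lemma computable_pair f g : computable_fun f -> computable_fun g ->
  computable_fun (fun z => pair_code (f z) (g z)).
Proof.
by move=> [c cP] [d dP]; exists (Pair c d) => n; apply: eval_pair.
Qed.

Lemma computable_id : computable_fun (fun z => z).
Proof.
exists (Pair Fst Snd) => n; rewrite -{1 2}(unpairK n).
by apply: eval_pair; [exact: eval_fst|exact: eval_snd].
Qed.

Lemma computable_succ f : computable_fun f -> computable_fun (fun z => (f z).+1).
Proof. by apply: computable_comp; exists Succ => n; exact: eval_succ. Qed.

Lemma computable_cst n : computable_fun (fun _ => n).
Proof.
elim: n => [|n IH]; first by exists Zero => n; exact: eval_zero.
exact: computable_succ.
Qed.

(** [Prec] hands its first argument unchanged to every step; passing the whole of [z] there lets
    base, step and number of rounds all depend on [z]. *)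
Lemma computable_rec (a n : nat -> nat) (g : nat -> nat -> nat -> nat) :
  computable_fun a ->
  computable_fun
    (fun w => g (unpair1 w) (unpair1 (unpair2 w)) (unpair2 (unpair2 w))) ->
  computable_fun n ->
  computable_fun (fun z => nat_rect (fun=> nat) (a z) (g z) (n z)).
Proof.
move=> [c cP] [d dP] hn.
have [e eP] : computable_fun (fun w =>
    nat_rect (fun=> nat) (a (unpair1 w)) (g (unpair1 w)) (unpair2 w)).
  exists (Prec c d) => w; rewrite -{1}(unpairK w).
  elim: (unpair2 w) => [|k IH] /=; first exact: eval_prec0.
  apply: eval_precS IH _.
  by have := dP (pair_code (unpair1 w) (pair_code k
    (nat_rect (fun=> nat) (a (unpair1 w)) (g (unpair1 w)) k)));
    rewrite !(pair_codeK1, pair_codeK2).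
have := computable_comp (ex_intro _ e eP) (computable_pair computable_id hn).
by apply: eq_computable_fun => z; rewrite pair_codeK1 pair_codeK2.
Qed.

Lemma computable_iter (a n : nat -> nat) (g : nat -> nat) :
  computable_fun a -> computable_fun g -> computable_fun n ->
  computable_fun (fun z => iter (n z) g (a z)).
Proof.
move=> ha hg hn.
have hg' : computable_fun (fun w => g (unpair2 (unpair2 w))).
  by apply: (computable_comp hg); do 2!apply: computable_unpair2;
     exact: computable_id.
have := computable_rec (g := fun _ _ y => g y) ha hg' hn.
by apply: eq_computable_fun => z; elim: (n z) => //= k ->.
Qed.

Lemma computable_pred f : computable_fun f -> computable_fun (fun z => (f z).-1).
Proof.
move=> hf; have hg : computable_fun (fun w => unpair1 (unpair2 w)).
  by apply: computable_unpair1; apply: computable_unpair2; exact: computable_id.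
have := computable_rec (g := fun _ k _ => k) (computable_cst 0) hg hf.
by apply: eq_computable_fun => z; case: (f z).
Qed.

Lemma computable_sub f g : computable_fun f -> computable_fun g ->
  computable_fun (fun z => f z - g z).
Proof.
move=> hf hg.
have := computable_iter hf (computable_pred computable_id) hg.
by apply: eq_computable_fun => z; elim: (g z) => [|k /= ->]; rewrite ?subn0 ?subnS.
Qed.

Lemma computable_add f g : computable_fun f -> computable_fun g ->
  computable_fun (fun z => f z + g z).
Proof.
move=> hf hg.
have := computable_iter hf (computable_succ computable_id) hg.
by apply: eq_computable_fun => z; elim: (g z) => [|k /= ->]; rewrite ?addn0 ?addnS.
Qed.

Lemma computable_sum (F : nat -> nat -> nat) (n : nat -> nat) :
  computable_fun (fun w => F (unpair1 w) (unpair2 w)) -> computable_fun n ->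
  computable_fun (fun z => \sum_(k < n z) F z k).
Proof.
move=> hF hn.
have hg : computable_fun (fun w =>
    unpair2 (unpair2 w) + F (unpair1 w) (unpair1 (unpair2 w))).
  have hid := computable_id; apply: computable_add.
    by do 2!apply: computable_unpair2.
  have := computable_comp hF (computable_pair (computable_unpair1 hid)
    (computable_unpair1 (computable_unpair2 hid))).
  by apply: eq_computable_fun => w; rewrite pair_codeK1 pair_codeK2.
have := computable_rec (g := fun z k y => y + F z k) (computable_cst 0) hg hn.
apply: eq_computable_fun => z.
by elim: (n z) => [|k /= ->]; rewrite ?big_ord0 ?big_ord_recr.
Qed.

Lemma computable_mul f g : computable_fun f -> computable_fun g ->
  computable_fun (fun z => f z * g z).
Proof.
move=> hf hg.
have := computable_sum (F := fun z _ => f z)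
  (computable_comp hf (computable_unpair1 computable_id)) hg.
by apply: eq_computable_fun => z; rewrite sum_nat_const card_ord mulnC.
Qed.

Lemma computable_exp2 f : computable_fun f -> computable_fun (fun z => 2 ^ f z).
Proof.
move=> hf; have := computable_iter (computable_cst 1)
  (computable_mul (computable_cst 2) computable_id) hf.
by apply: eq_computable_fun => z; elim: (f z) => //= k ->; rewrite expnS.
Qed.

Lemma computable_leq f g : computable_fun f -> computable_fun g ->
  computable_fun (fun z => f z <= g z : nat).
Proof.
move=> hf hg.
have := computable_sub (computable_cst 1) (computable_sub hf hg).
by apply: eq_computable_fun => z; rewrite /leq; case: (f z - g z).
Qed.

Lemma computable_and (b c : nat -> bool) :
  computable_fun b -> computable_fun c -> computable_fun (fun z => b z && c z).
Proof.
move=> hb hc; have := computable_mul hb hc.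
by apply: eq_computable_fun => z; case: (b z) (c z) => [] [].
Qed.

Lemma computable_neg (b : nat -> bool) :
  computable_fun b -> computable_fun (fun z => ~~ b z).
Proof.
move=> hb; have := computable_sub (computable_cst 1) hb.
by apply: eq_computable_fun => z; case: (b z).
Qed.

Lemma computable_eq f g : computable_fun f -> computable_fun g ->
  computable_fun (fun z => f z == g z).
Proof.
move=> hf hg.
have := computable_and (computable_leq hf hg) (computable_leq hg hf).
by apply: eq_computable_fun => z; rewrite -eqn_leq.
Qed.

Lemma computable_if (b : nat -> bool) f g :
  computable_fun b -> computable_fun f -> computable_fun g ->
  computable_fun (fun z => if b z then f z else g z).
Proof.
move=> hb hf hg.
have := computable_add (computable_mul hb hf) (computable_mul (computable_neg hb) hg).
by apply: eq_computable_fun => z; case: (b z); rewrite ?mul1n ?mul0n ?addn0.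
Qed.

Lemma computable_has (P : nat -> nat -> bool) (n : nat -> nat) :
  computable_fun (fun w => P (unpair1 w) (unpair2 w)) -> computable_fun n ->
  computable_fun (fun z => has (P z) (iota 0 (n z))).
Proof.
move=> hP hn.
have := computable_leq (computable_cst 1)
  (computable_sum (F := fun z k => P z k) hP hn).
apply: eq_computable_fun => z; rewrite has_count; congr (nat_of_bool (0 < _)).
rewrite -sum1_count -[n z in RHS]subn0 -/(index_iota 0 (n z)) big_mkord.
by rewrite [RHS]big_mkcond; apply: eq_bigr => i _; case: (P z i).
Qed.

Lemma computable_all (P : nat -> nat -> bool) (n : nat -> nat) :
  computable_fun (fun w => P (unpair1 w) (unpair2 w)) -> computable_fun n ->
  computable_fun (fun z => all (P z) (iota 0 (n z))).
Proof.
move=> hP hn; have := computable_neg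
  (computable_has (P := fun z k => ~~ P z k) (computable_neg hP) hn).
by apply: eq_computable_fun => z; rewrite has_predC negbK.
Qed.

Lemma computable_find (P : nat -> nat -> bool) (n : nat -> nat) :
  computable_fun (fun w => P (unpair1 w) (unpair2 w)) -> computable_fun n ->
  computable_fun (fun z => find (P z) (iota 0 (n z))).
Proof.
move=> hP hn; have hid := computable_id.
(* [F z k] is 1 as long as no index up to [k] satisfies [P z], so the sum of [F z] counts the
   indices before the first success; without a success it is the full length, as for [find]. *)
pose F z k : nat := ~~ has (P z) (iota 0 k.+1).
have hF : computable_fun (fun w => F (unpair1 w) (unpair2 w)).
  apply: computable_neg.
  apply: (computable_has (P := fun w => P (unpair1 w))); last first.
    by apply: computable_succ; exact: computable_unpair2.
  have := computable_comp hP (computable_pair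
    (computable_unpair1 (computable_unpair1 hid)) (computable_unpair2 hid)).
  by apply: eq_computable_fun => w; rewrite pair_codeK1 pair_codeK2.
have := computable_sum hF hn; apply: eq_computable_fun => z.
elim: (n z) => [|k IH]; first by rewrite big_ord0.
rewrite -[k.+1 in RHS]addn1 iotaD find_cat size_iota add0n big_ord_recr IH /F.
rewrite [nat_of_ord _]/= -[k.+1]addn1 iotaD has_cat add0n.
case: ifPn => [_|/hasNfind]; first by rewrite /= addn0.
by rewrite size_iota => ->; rewrite /= orbF; case: (P z k).
Qed.

Lemma computable_string_code (f : nat -> nat -> bool) (n : nat -> nat) :
  computable_fun (fun w => f (unpair1 w) (unpair2 w)) -> computable_fun n ->
  computable_fun (fun z => string_code (mkseq (f z) (n z))).
Proof.
move=> hf hn; pose F z k := (f z k).+1 * 2 ^ k.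
have hF : computable_fun (fun w => F (unpair1 w) (unpair2 w)).
  apply: computable_mul; first exact: computable_succ.
  by apply: computable_exp2; apply: computable_unpair2; exact: computable_id.
have := computable_sum hF hn; apply: eq_computable_fun => z.
rewrite -(big_mkord predT (F z)) /mkseq; move: (n z) => k.
suff H j : \sum_(j <= i < j + k) F z i
    = 2 ^ j * string_code [seq f z i | i <- iota j k].
  by have := H 0; rewrite mul1n.
elim: k j => [|k IH] j; first by rewrite addn0 big_geq ?muln0.
rewrite big_ltn ?addnS ?ltnS ?leq_addr // -addSn IH /F /= expnS; lia.
Qed.

(** * Step-bounded evaluation *)

(* [E s x] is [y.+1] when the computation on [x] is seen within [s] steps to
   output [y], and [0] when no output is seen yet. *)
Definition bounded_eval (c : code) (E : nat -> nat -> nat) : Prop :=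
  [/\ computable_fun (fun w => E (unpair1 w) (unpair2 w)),
      forall s t x y, s <= t -> E s x = y.+1 -> E t x = y.+1 &
      forall x y, eval c x y <-> exists s, E s x = y.+1].

Lemma computable_binary (E : nat -> nat -> nat) f g :
  computable_fun (fun w => E (unpair1 w) (unpair2 w)) ->
  computable_fun f -> computable_fun g -> computable_fun (fun z => E (f z) (g z)).
Proof.
move=> hE hf hg; have := computable_comp hE (computable_pair hf hg).
by apply: eq_computable_fun => z; rewrite pair_codeK1 pair_codeK2.
Qed.

Lemma bounded_eval_total (c : code) (f : nat -> nat) :
  computable_fun f -> (forall x y, eval c x y <-> y = f x) ->
  bounded_eval c (fun _ x => (f x).+1).
Proof.
move=> hf cP; split=> //.
  by apply: computable_succ; apply: (computable_comp hf);
     apply: computable_unpair2; exact: computable_id.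
by move=> x y; rewrite cP; split=> [->|[_ [->]]] //; exists 0.
Qed.

Lemma eval_pair_inv f g x y : eval (Pair f g) x y ->
  exists u v, [/\ eval f x u, eval g x v & y = pair_code u v].
Proof.
by move=> H; inversion H as [| | | |? ? ? u v| | | |]; subst; exists u, v.
Qed.

Lemma eval_comp_inv f g x z : eval (Comp f g) x z ->
  exists2 y, eval g x y & eval f y z.
Proof.
by move=> H; inversion H as [| | | | |? ? ? y| | |]; subst; exists y.
Qed.

Lemma bounded_eval_pair c d E F :
  bounded_eval c E -> bounded_eval d F ->
  bounded_eval (Pair c d) (fun s x => if (0 < E s x) && (0 < F s x)
     then (pair_code (E s x).-1 (F s x).-1).+1 else 0).
Proof.
move=> [hE Em EP] [hF Fm FP]; split.
- apply: computable_if; last exact: computable_cst.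
    by apply: computable_and; apply: computable_leq => //; exact: computable_cst.
  by apply: computable_succ; apply: computable_pair; exact: computable_pred.
- move=> s t x y st; case e: (E s x) => [|u] //; case f: (F s x) => [|v] //=.
  by rewrite (Em _ _ _ _ st e) (Fm _ _ _ _ st f).
move=> x y; split=> [H|[s]].
  have [u [v [/EP[s e] /FP[t f] ->]]] := eval_pair_inv H.
  exists (maxn s t).
  by rewrite (Em _ _ _ _ (leq_maxl _ _) e) (Fm _ _ _ _ (leq_maxr _ _) f).
case e: (E s x) => [|u] //; case f: (F s x) => [|v] //= -[<-].
by apply: eval_pair; [apply/EP|apply/FP]; exists s.
Qed.

Lemma bounded_eval_comp c d E F :
  bounded_eval c E -> bounded_eval d F ->
  bounded_eval (Comp c d) (fun s x => if 0 < F s x then E s (F s x).-1 else 0).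
Proof.
move=> [hE Em EP] [hF Fm FP]; split.
- apply: computable_if; last exact: computable_cst.
    by apply: computable_leq => //; exact: computable_cst.
  apply: (computable_binary hE); last exact: computable_pred.
  by apply: computable_unpair1; exact: computable_id.
- move=> s t x y st; case f: (F s x) => [|v] //= e.
  by rewrite (Fm _ _ _ _ st f) (Em _ _ _ _ st e).
move=> x y; split=> [H|[s]].
  have [v /FP[t f] /EP[s e]] := eval_comp_inv H.
  exists (maxn s t).
  by rewrite (Fm _ _ _ _ (leq_maxr _ _) f) (Em _ _ _ _ (leq_maxl _ _) e).
case f: (F s x) => [|v] //= e.
by apply: (@eval_comp _ _ _ v); [apply/FP|apply/EP]; exists s.
Qed.

(** The input is a value of [pair_code], not a constructor term, so the inversion is done by hand:
    the indices are generalised and equal codes are compared through [unpair1] and [unpair2]. *)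
Lemma eval_prec_inv0 f g a y :
  eval (Prec f g) (pair_code a 0) y -> eval f a y.
Proof.
move eqc: (Prec f g) => c; move eqx: (pair_code a 0) => x H.
case: H eqc eqx => //.
- move=> f' g' b z H [ef _] e.
  by have := congr1 unpair1 e; rewrite !pair_codeK1 ef => ->.
- by move=> f' g' b n z w _ _ _ /(congr1 unpair2); rewrite !pair_codeK2.
Qed.

Lemma eval_prec_invS f g a n z :
  eval (Prec f g) (pair_code a n.+1) z ->
  exists2 y, eval (Prec f g) (pair_code a n) y
    & eval g (pair_code a (pair_code n y)) z.
Proof.
move eqc: (Prec f g) => c; move eqx: (pair_code a n.+1) => x H.
case: H eqc eqx => //.
- by move=> f' g' b w _ _ /(congr1 unpair2); rewrite !pair_codeK2.
- move=> f' g' b m w v H1 H2 [ef eg] e.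
  have := congr1 unpair1 e; have := congr1 unpair2 e.
  by rewrite !(pair_codeK1, pair_codeK2) eg => -[->] ->; exists w.
Qed.

(** The value 0, for no output yet, is passed on by every later round, so a positive result
    certifies that all earlier rounds were seen to halt. *)
Lemma bounded_eval_prec c d E F :
  bounded_eval c E -> bounded_eval d F ->
  bounded_eval (Prec c d) (fun s x => nat_rect (fun=> nat) (E s (unpair1 x))
    (fun n y => if 0 < y then F s (pair_code (unpair1 x) (pair_code n y.-1)) else 0)
    (unpair2 x)).
Proof.
move=> [hE Em EP] [hF Fm FP]; have hid := computable_id.
have h1 := computable_unpair1; have h2 := computable_unpair2.
set G := (X in bounded_eval _ X).
have G0 s a : G s (pair_code a 0) = E s a.
  by rewrite /G pair_codeK1 pair_codeK2.
have GS s a n : G s (pair_code a n.+1) = if 0 < G s (pair_code a n)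
    then F s (pair_code a (pair_code n (G s (pair_code a n)).-1)) else 0.
  by rewrite /G !pair_codeK1 !pair_codeK2.
have Gm s t x y : s <= t -> G s x = y.+1 -> G t x = y.+1.
  move=> st; rewrite -(unpairK x); elim: (unpair2 x) y => [|n IH] y.
    by rewrite !G0; exact: Em.
  rewrite !GS; case g: (G s _) => [|v] //=; rewrite (IH _ g) /=; exact: Fm.
split=> //.
- apply: (computable_rec (g := fun w n y => if 0 < y
    then F (unpair1 w) (pair_code (unpair1 (unpair2 w)) (pair_code n y.-1)) else 0)).
  + by apply: (computable_binary hE); [apply: h1|apply/h1/h2].
  + apply: computable_if; last exact: computable_cst.
      by apply: computable_leq; [exact: computable_cst|apply/h2/h2].
    apply: (computable_binary hF); first exact/h1/h1.
    apply: computable_pair; first exact/h1/h2/h1.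
    by apply: computable_pair; [exact/h1/h2|apply/computable_pred/h2/h2].
  + exact/h2/h2.
move=> x y; rewrite -(unpairK x).
elim: (unpair2 x) y => [|n IH] y.
  split=> [/eval_prec_inv0/EP[s e]|[s]]; first by exists s; rewrite G0.
  by rewrite G0 => e; apply: eval_prec0; apply/EP; exists s.
split=> [/eval_prec_invS[u /IH[s e] /FP[t f]]|[s]].
  exists (maxn s t); rewrite GS.
  by rewrite (Gm _ _ _ _ (leq_maxl s t) e) (Fm _ _ _ _ (leq_maxr s t) f).
rewrite GS; case e: (G s _) => [|v] //= f.
by apply: (@eval_precS _ _ _ _ v); [apply/IH|apply/FP]; exists s.
Qed.

Lemma eval_find_inv f x n : eval (Find f) x n ->
  exists2 h : nat -> nat,
    forall m, m < n -> eval f (pair_code x m) (h m).+1 & eval f (pair_code x n) 0.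
Proof. by move=> H; inversion H as [| | | | | | | |? ? ? h]; subst; exists h. Qed.

(** The stage bounds both the computations and the range of the search. The search stops at the
    first [m] whose output is 0 or not yet seen ([E] at most 1), and succeeds only if the output
    there is seen to be 0. *)
Lemma bounded_eval_find c E :
  bounded_eval c E ->
  bounded_eval (Find c) (fun s x =>
    let n := find (fun m => E s (pair_code x m) <= 1) (iota 0 s) in
    if (n < s) && (E s (pair_code x n) == 1) then n.+1 else 0).
Proof.
move=> [hE Em EP]; have hid := computable_id.
have h1 := computable_unpair1; have h2 := computable_unpair2.
set G := (X in bounded_eval _ X).
have GP s x n : G s x = n.+1 <-> [/\ n < s, E s (pair_code x n) = 1 &
    forall m, m < n -> 1 < E s (pair_code x m)].
  rewrite /G; set k := find _ _; split.
    case: ifP => // /andP[ks /eqP e] [<-]; split=> // m mk.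
    have := before_find 0 mk; rewrite nth_iota ?add0n; first by case: ltngtP.
    exact: ltn_trans mk ks.
  move=> [ns e H]; suff -> : k = n by rewrite ns e eqxx.
  have hh : has (fun m => E s (pair_code x m) <= 1) (iota 0 s).
    by apply/hasP; exists n; rewrite ?mem_iota ?e.
  have ks : k < s by rewrite -[X in _ < X](size_iota 0) -has_find.
  have := nth_find 0 hh; rewrite -/k nth_iota // add0n => ke.
  case: (ltngtP k n) => // [kn|nk]; first by have := H _ kn; rewrite ltnNge ke.
  by have := before_find 0 nk; rewrite nth_iota // add0n e.
have Gm s t x y : s <= t -> G s x = y.+1 -> G t x = y.+1.
  move=> st /GP[ns e H]; apply/GP; split; first exact: leq_trans ns st.
    exact: Em st e.
  move=> m /H; case e': (E s _) => [|[|v]] // _.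
  by rewrite (Em _ _ _ _ st e').
split=> //.
- have hf : computable_fun (fun w =>
      find (fun m => E (unpair1 w) (pair_code (unpair2 w) m) <= 1)
        (iota 0 (unpair1 w))).
    apply: (computable_find (P := fun w m =>
      E (unpair1 w) (pair_code (unpair2 w) m) <= 1)); last exact: h1.
    apply: computable_leq; last exact: computable_cst.
    apply: (computable_binary hE); first exact/h1/h1.
    by apply: computable_pair; [exact/h2/h1|exact: h2].
  apply: computable_if; last exact: computable_cst.
    apply: computable_and.
      by apply: computable_leq; [exact: computable_succ|exact: h1].
    apply: computable_eq; last exact: computable_cst.
    apply: (computable_binary hE); first exact: h1.
    by apply: computable_pair => //; exact: h2.
  exact: computable_succ.
move=> x n; split=> [H|[s /GP[ns e H]]].
  have [h hP f0] := eval_find_inv H.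
  have [s0 s0P] : exists s, forall m, m < n -> E s (pair_code x m) = (h m).+2.
    elim: n hP {H f0} => [|n IH] hP; first by exists 0.
    have [s sP] := IH (fun m mn => hP m (ltnW mn)).
    have [t tP] := (EP _ _).1 (hP n (ltnSn n)).
    exists (maxn s t) => m; rewrite ltnS leq_eqVlt => /orP[/eqP ->|/sP].
      exact: Em (leq_maxr _ _) tP.
    exact: Em (leq_maxl _ _).
  have [t te] := (EP _ _).1 f0.
  (* The summand [n.+1] makes the search range reach [n]. *)
  exists (n.+1 + (maxn s0 t)); apply/GP; split; first exact: leq_addr.
    by apply: Em te; rewrite (leq_trans (leq_maxr s0 t)) // leq_addl.
  move=> m /s0P /Em -> //.
  by rewrite (leq_trans (leq_maxl s0 t)) // leq_addl.
(* One predecessor undoes the shift in [E], the other the successor in [eval_find]. *)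
apply: (@eval_find _ _ _ (fun m => (E s (pair_code x m)).-2)).
  move=> m /H lt; apply/EP; exists s.
  by case: (E s _) lt => [|[|]].
by apply/EP; exists s.
Qed.

Lemma bounded_eval_exists c : exists E, bounded_eval c E.
Proof.
have hid := computable_id.
elim: c => [| | | |c [E hE] d [F hF]|c [E hE] d [F hF]|c [E hE] d [F hF]|c [E hE]].
- eexists; apply: (@bounded_eval_total _ (fun=> 0)); first exact: computable_cst.
  by move=> x y; split=> [H|->]; [inversion H|exact: eval_zero].
- eexists; apply: (@bounded_eval_total _ succn); first exact: computable_succ.
  by move=> x y; split=> [H|->]; [inversion H|exact: eval_succ].
- eexists; apply: (@bounded_eval_total _ unpair1); first exact: computable_unpair1.
  move=> x y; split=> [H|->]; first by inversion H; rewrite pair_codeK1.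
  by rewrite -{1}(unpairK x); exact: eval_fst.
- eexists; apply: (@bounded_eval_total _ unpair2); first exact: computable_unpair2.
  move=> x y; split=> [H|->]; first by inversion H; rewrite pair_codeK2.
  by rewrite -{1}(unpairK x); exact: eval_snd.
- by eexists; exact: bounded_eval_pair hE hF.
- by eexists; exact: bounded_eval_comp hE hF.
- by eexists; exact: bounded_eval_prec hE hF.
- by eexists; exact: bounded_eval_find hE.
Qed.

(** Outputs seen at stages [s] and [t] are both seen at stage [maxn s t], where [E] has a single
    value. *)
Lemma eval_functional c x y z : eval c x y -> eval c x z -> y = z.
Proof.
have [E [_ Em EP]] := bounded_eval_exists c.
move=> /EP[s e] /EP[t f].
by have := Em _ _ _ _ (leq_maxl s t) e; rewrite (Em _ _ _ _ (leq_maxr s t) f) => -[].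
Qed.

(** Minimisation searches for an [s] with [P k s]; it is applied to the negation because [Find]
    looks for the value 0. *)
Lemma comp_enumerable_exists (P : nat -> nat -> bool) :
  computable_fun (fun w => P (unpair1 w) (unpair2 w)) ->
  comp_enumerable [set k : nat | exists s, P k s].
Proof.
move=> /computable_neg [c cP]; exists (Find c) => k; split=> [[s0 s0P]|[y H]].
  have [n nP nmin] := ex_minnP (ex_intro _ s0 s0P : exists s, P k s).
  exists n; apply: (@eval_find _ _ _ (fun=> 0)) => [m mn|].
    have := cP (pair_code k m); rewrite pair_codeK1 pair_codeK2.
    by case: (P k m) (nmin m) => // /(_ isT); rewrite leqNgt mn.
  by have := cP (pair_code k n); rewrite pair_codeK1 pair_codeK2 nP.
have [_ _ f0] := eval_find_inv H.
have := eval_functional f0 (cP (pair_code k y)).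
by rewrite pair_codeK1 pair_codeK2; case e: (P k y) => // _; exists y.
Qed.

(** * The construction *)

(* At stage [t] the strategy [unpair1 t] may act; strategy [i] owns the interval
   [2^i, 2^(i+1)) and every action adds the next element of that interval. The
   parameter [a] tells at which stages an action takes place. *)
Definition act_count (a : nat -> bool) (s i : nat) : nat :=
  \sum_(t < s) ((unpair1 t == i) && a t).

(** The range [iota 0 k] misses no strategy, since [2 ^ i <= k] forces [i < k]. *)
Definition enum_by (a : nat -> bool) (s k : nat) : bool :=
  has (fun i => (2 ^ i <= k) && (k < 2 ^ i + act_count a s i)) (iota 0 k).

(* An action of a strategy at stage [t] kills every larger [i <= t] for ever. *)
Definition alive (a : nat -> bool) (s i : nat) : bool :=
  all (fun t => ~~ [&& i <= t, unpair1 t < i & a t]) (iota 0 s).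

(** Programs are given by their [string_code]; those of length less than [2 * i] have codes below
    [2 ^ i * 2 ^ i]. All lengths are at least [2 * 2 ^ i], so that each prefix contains the whole
    interval of strategy [i]. *)
Definition described (E : nat -> nat -> nat) (a : nat -> bool) (s i : nat) : bool :=
  all (fun r => has (fun m =>
      E s m == (string_code (mkseq (enum_by a s) (2 * 2 ^ i + r))).+1)
    (iota 0 (2 ^ i * 2 ^ i))) (iota 0 (2 ^ i)).

Definition attention (E : nat -> nat -> nat) (a : nat -> bool) (s : nat) : bool :=
  [&& alive a s (unpair1 s), act_count a s (unpair1 s) < 2 ^ unpair1 s
    & described E a s (unpair1 s)].

Lemma eq_act_count a b s i :
  (forall t, t < s -> a t = b t) -> act_count a s i = act_count b s i.
Proof. by move=> ab; apply: eq_bigr => t _; rewrite ab. Qed.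

Lemma eq_enum_by a b s k :
  (forall t, t < s -> a t = b t) -> enum_by a s k = enum_by b s k.
Proof. by move=> ab; apply: eq_has => i; rewrite (eq_act_count _ ab). Qed.

(** Attention at [s] consults [a] only before [s], which allows [a] to be defined from attention by
    recursion on stages. *)
Lemma eq_attention E a b s :
  (forall t, t < s -> a t = b t) -> attention E a s = attention E b s.
Proof.
move=> ab; rewrite /attention (eq_act_count _ ab); congr [&& _, _ & _].
  by apply: eq_in_all => t; rewrite mem_iota => /ab ->.
apply: eq_all => r; apply: eq_has => m; congr (_ == (string_code _).+1).
by apply: eq_map => k; exact: eq_enum_by.
Qed.

(** A history is a nest of pairs with the latest decision outermost; peeling [s - t.+1] layers off a
    history of length [s] brings decision [t] to the top. *)
Definition lookup (h s t : nat) : bool := 0 < unpair2 (iter (s - t.+1) unpair1 h).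

Definition history (E : nat -> nat -> nat) (s : nat) : nat :=
  nat_rect (fun=> nat) 0 (fun t h => pair_code h (attention E (lookup h t) t)) s.

Definition action (E : nat -> nat -> nat) (t : nat) : bool :=
  0 < unpair2 (history E t.+1).

(** The recursion equation of the construction: [lookup] in [history E s] returns the earlier values
    of [action E], and attention depends on no others. *)
Lemma actionE E s : action E s = attention E (action E) s.
Proof.
have iterH k n : iter k unpair1 (history E (k + n)) = history E n.
  by elim: k => [//|k IH]; rewrite iterSr addSn /= pair_codeK1.
rewrite {1}/action /= pair_codeK2 lt0b; apply: eq_attention => t ts.
by rewrite /lookup /action -[X in history E X](subnK ts) iterH.
Qed.

(** * Computability of the construction *)

Lemma computable_act_count (a : nat -> nat -> bool) (n i : nat -> nat) :
  computable_fun (fun w => a (unpair1 w) (unpair2 w)) ->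
  computable_fun n -> computable_fun i ->
  computable_fun (fun z => act_count (a z) (n z) (i z)).
Proof.
move=> ha hn hi; have hid := computable_id.
apply: (computable_sum (F := fun z t => (unpair1 t == i z) && a z t)) => //.
apply: computable_and => //; apply: computable_eq.
  by apply: computable_unpair1; exact: computable_unpair2.
exact: computable_comp (computable_unpair1 _).
Qed.

Lemma computable_enum_by (a : nat -> nat -> bool) (n k : nat -> nat) :
  computable_fun (fun w => a (unpair1 w) (unpair2 w)) ->
  computable_fun n -> computable_fun k ->
  computable_fun (fun z => enum_by (a z) (n z) (k z)).
Proof.
move=> ha hn hk; have hid := computable_id.
have h1 := computable_unpair1; have h2 := computable_unpair2.
apply: (computable_has (P := fun z i =>
  (2 ^ i <= k z) && (k z < 2 ^ i + act_count (a z) (n z) i))) => //.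
apply: computable_and; apply: computable_leq.
- by apply: computable_exp2; exact: h2.
- exact: computable_comp (h1 _ hid).
- by apply: computable_succ; exact: computable_comp (h1 _ hid).
apply: computable_add; first by apply: computable_exp2; exact: h2.
apply: (computable_act_count (a := fun w => a (unpair1 w))); last exact: h2.
  apply: (computable_binary (E := fun z t => a z t)) => //; last exact: h2.
  exact/h1/h1.
exact: computable_comp (h1 _ hid).
Qed.

(** The decisions [a z] vary with [z] because the recursion in [history] decodes them from a
    changing history code. *)
Lemma computable_attention E (a : nat -> nat -> bool) (s : nat -> nat) :
  computable_fun (fun w => E (unpair1 w) (unpair2 w)) ->
  computable_fun (fun w => a (unpair1 w) (unpair2 w)) -> computable_fun s ->
  computable_fun (fun z => attention E (a z) (s z)).
Proof.
move=> hE ha hs; have hid := computable_id.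
have h1 := computable_unpair1; have h2 := computable_unpair2.
have hs1 := h1 _ hs; have hp : computable_fun (fun z => 2 ^ unpair1 (s z)).
  exact: computable_exp2.
have hc f g : computable_fun f -> computable_fun g ->
    computable_fun (fun z => f (g z)) by exact: computable_comp.
have ha' f g : computable_fun f -> computable_fun g ->
    computable_fun (fun z => a (f z) (g z)).
  exact: (computable_binary (E := fun z t => a z t)).
apply: computable_and; last apply: computable_and.
- apply: (computable_all (P := fun z t =>
    ~~ [&& unpair1 (s z) <= t, unpair1 t < unpair1 (s z) & a z t])) => //.
  apply: computable_neg; apply: computable_and; last apply: computable_and => //.
    by apply: computable_leq; [exact/(hc (fun z => unpair1 (s z)))/h1|exact: h2].
  apply: computable_leq; last exact/(hc (fun z => unpair1 (s z)))/h1.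
  by apply: computable_succ; exact/h1/h2.
- by apply: computable_leq => //; apply: computable_succ; exact: computable_act_count.
apply: (computable_all (P := fun z r => has (fun m => E (s z) m ==
    (string_code (mkseq (enum_by (a z) (s z)) (2 * 2 ^ unpair1 (s z) + r))).+1)
  (iota 0 (2 ^ unpair1 (s z) * 2 ^ unpair1 (s z))))) => //.
apply: (computable_has (P := fun w m => E (s (unpair1 w)) m ==
    (string_code (mkseq (enum_by (a (unpair1 w)) (s (unpair1 w)))
       (2 * 2 ^ unpair1 (s (unpair1 w)) + unpair2 w))).+1)); last first.
  by apply: (hc (fun z => 2 ^ unpair1 (s z) * 2 ^ unpair1 (s z)));
    [exact: computable_mul|exact: h1].
apply: computable_eq.
  by apply: (computable_binary hE); [exact/(hc s)/h1/h1|exact: h2].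
apply: computable_succ.
apply: (computable_string_code (f := fun v =>
   enum_by (a (unpair1 (unpair1 v))) (s (unpair1 (unpair1 v))))).
  apply: (computable_enum_by (a := fun u => a (unpair1 (unpair1 (unpair1 u)))));
    last exact: h2.
    by apply: ha'; [exact/h1/h1/h1/h1|exact: h2].
  exact/(hc s)/h1/h1/h1.
apply: computable_add; last exact/h2/h1.
apply: computable_mul; first exact: computable_cst.
exact/(hc (fun z => 2 ^ unpair1 (s z)))/h1/h1.
Qed.

Lemma computable_history E :
  computable_fun (fun w => E (unpair1 w) (unpair2 w)) ->
  computable_fun (history E).
Proof.
move=> hE; have hid := computable_id.
have h1 := computable_unpair1; have h2 := computable_unpair2.
apply: (computable_rec (a := fun=> 0)
  (g := fun _ t h => pair_code h (attention E (lookup h t) t))) => //.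
  exact: computable_cst.
apply: computable_pair; first exact/h2/h2.
apply: (computable_attention (a := fun w =>
    lookup (unpair2 (unpair2 w)) (unpair1 (unpair2 w)))) => //; last exact/h1/h2.
apply: computable_leq; first exact: computable_cst.
apply: computable_unpair2; apply: computable_iter; [exact/h2/h2/h1|exact: h1|].
apply: computable_sub; first exact/h1/h2/h1.
by apply: computable_succ; exact: h2.
Qed.

Lemma computable_action E :
  computable_fun (fun w => E (unpair1 w) (unpair2 w)) ->
  computable_fun (fun t => action E t).
Proof.
move=> /computable_history hE.
apply: computable_leq; first exact: computable_cst.
apply: computable_unpair2; apply: (computable_comp hE).
exact: computable_succ computable_id.
Qed.

(** * Permanent strategies and the counting argument *)

Lemma act_countS a s i : act_count a s.+1 i = act_count a s i + ((unpair1 s == i) && a s).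
Proof. by rewrite /act_count big_ord_recr. Qed.

Lemma leq_act_count a s t i : s <= t -> act_count a s i <= act_count a t i.
Proof.
elim: t => [|t IH]; first by rewrite leqn0 => /eqP ->.
rewrite leq_eqVlt => /orP[/eqP -> //|/IH H].
by rewrite act_countS (leq_trans H) ?leq_addr.
Qed.

Lemma leq_enum_by a s t k : s <= t -> enum_by a s k -> enum_by a t k.
Proof.
move=> st; apply: sub_has => i /andP[-> H] /=.
by apply: leq_trans H _; rewrite leq_add2l leq_act_count.
Qed.

Lemma stabilizes (f : nat -> nat) b : {homo f : s t / s <= t} ->
  (forall s, f s <= b) -> exists s0, forall s, s0 <= s -> f s = f s0.
Proof.
move=> fm; elim: b => [|b IH] fb.
  by exists 0 => s _; move: (fb s) (fb 0); rewrite !leqn0 => /eqP -> /eqP ->.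
have [[s fs]|H] := pselect (exists s, f s = b.+1).
  by exists s => t st; apply/eqP; rewrite eqn_leq (fm _ _ st) andbT fs fb.
apply: IH => s; have := fb s; rewrite leq_eqVlt ltnS => /orP[/eqP e|//].
by case: H; exists s.
Qed.

(** Equivalently, [alive a s i] at every stage [s]: strategy [i] is never killed. *)
Definition permanent (a : nat -> bool) (i : nat) : Prop :=
  forall t, i <= t -> unpair1 t < i -> ~~ a t.

Lemma act_count_permanent a i j s :
  permanent a i -> j < i -> i <= s -> act_count a s j = act_count a i j.
Proof.
move=> pi ji; elim: s => [|s IH]; first by rewrite leqn0 => /eqP ->.
rewrite leq_eqVlt => /orP[/eqP <- //|lt]; rewrite act_countS IH //.
case: eqP => [e|_]; last by rewrite addn0.
by rewrite (negbTE (pi s lt _)) ?addn0 ?e.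
Qed.

(** Points below [2 ^ i] belong to strategies [j < i], and none of these acts from stage [i] on. *)
Lemma enum_by_permanent a i k s :
  permanent a i -> k < 2 ^ i -> i <= s -> enum_by a s k = enum_by a i k.
Proof.
move=> pi ki lis; apply: eq_has => j; have [jk|] := boolP (2 ^ j <= k); last by [].
rewrite /= (act_count_permanent (s := s) pi) //.
by rewrite -(ltn_exp2l _ _ (ltnSn 1)) (leq_ltn_trans jk).
Qed.

(** The count grows by at most one per stage, so it equals [j] just before the action that makes it
    [j.+1]. *)
Lemma exists_act_count a s i j :
  j < act_count a s i -> exists t, [/\ act_count a t i = j, unpair1 t = i & a t].
Proof.
elim: s => [|s IH]; first by rewrite /act_count big_ord0.
rewrite act_countS; case: eqP => [e|_]; last by rewrite addn0.
case as_: (a s); last by rewrite addn0.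
rewrite addn1 ltnS leq_eqVlt => /orP[/eqP ->|/IH //].
by exists s.
Qed.

(** The bound on the counts confines every strategy to its own interval, so a point of
    [[2^i, 2^(i+1))] can only come from strategy [i], which fills its interval from the left. *)
Lemma enum_byE a s i j : (forall i, act_count a s i <= 2 ^ i) ->
  j < 2 ^ i -> enum_by a s (2 ^ i + j) = (j < act_count a s i).
Proof.
move=> cb ji; apply/hasP/idP => [[i' _ /andP[le1 lt2]]|H].
  suff e : i' = i by move: lt2; rewrite e ltn_add2l.
  have p n : 2 ^ n.+1 = 2 ^ n + 2 ^ n by rewrite expnS mul2n addnn.
  apply/eqP; rewrite eqn_leq; apply/andP; split.
    rewrite -ltnS -(ltn_exp2l _ _ (ltnSn 1)) (leq_ltn_trans le1) // p.
    by rewrite ltn_add2l.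
  rewrite -ltnS -(ltn_exp2l _ _ (ltnSn 1)) (leq_ltn_trans (leq_addr j _)) //.
  by rewrite p (leq_trans lt2) // leq_add2l.
exists i; last by rewrite leq_addr ltn_add2l.
by rewrite mem_iota /= add0n (leq_trans (ltn_expl i (ltnSn 1))) // leq_addr.
Qed.

Lemma act_count_bound E a s i :
  (forall s, a s = attention E a s) -> act_count a s i <= 2 ^ i.
Proof.
move=> aE; elim: s => [|s IH]; first by rewrite /act_count big_ord0.
rewrite act_countS; case: eqP => [e|_]; last by rewrite addn0.
case as_: (a s); last by rewrite addn0.
by move: as_; rewrite aE /attention e addn1 => /and3P[].
Qed.

(** By the bound on its count, strategy [i] acts only finitely often. If it never acts from stage
    [i] on, [i.+1] is permanent. Otherwise let [m] be the last stage at which it acts: then [m.+1]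
    is permanent, since strategies below [i] are silent by the permanence of [i], strategy [i] is
    finished, and those from [i.+1] to [m] were killed at stage [m]. *)
Lemma permanent_next E a i : (forall s, a s = attention E a s) ->
  permanent a i -> exists2 j, i < j & permanent a j.
Proof.
move=> aE pi.
have [s0 s0P] := stabilizes (fun s t => @leq_act_count a s t i)
  (fun s => act_count_bound s i aE).
have late t : s0 <= t -> unpair1 t = i -> ~~ a t.
  move=> st e; apply/negP => at_; have := s0P t.+1 (leqW st).
  by rewrite act_countS (s0P t st) e eqxx at_ /=; lia.
have alive_at t : a t -> alive a t (unpair1 t).
  by rewrite aE => /and3P[].
pose P t := [&& i <= t, unpair1 t == i & a t].
have [[t Pt]|noP] := pselect (exists t, P t); last first.
  exists i.+1 => // t it; rewrite ltnS leq_eqVlt => /orP[/eqP e|]; last first.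
    exact: pi (ltnW it).
  by apply/negP => at_; apply: noP; exists t; rewrite /P e eqxx at_ (ltnW it).
have Pb u : P u -> u <= s0.
  move=> /and3P[_ /eqP e au]; rewrite leqNgt; apply/negP => /ltnW lt.
  by have := late u lt e; rewrite au.
have [m /and3P[im /eqP em am] mmax] := ex_maxnP (ex_intro P t Pt) Pb.
exists m.+1; first by rewrite ltnS.
move=> u mu; rewrite ltnS => um; apply/negP => au.
case: (ltngtP (unpair1 u) i) => [lt|gt|e].
- by have := pi u (leq_trans im (ltnW mu)) lt; rewrite au.
- have /allP/(_ m) := alive_at _ au; rewrite mem_iota => /(_ mu).
  by rewrite um em gt am.
have : P u by rewrite /P e eqxx au (leq_trans im (ltnW mu)).
by move/mmax; rewrite leqNgt mu.
Qed.

Lemma permanent_unbounded E a N : (forall s, a s = attention E a s) ->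
  exists2 i, N <= i & permanent a i.
Proof.
(* No strategy is smaller than 0, so 0 is permanent. *)
move=> aE; elim: N => [|N [i Ni pi]]; first by exists 0.
have [j ij pj] := permanent_next aE pi; exists j => //.
exact: leq_ltn_trans ij.
Qed.

(** * The enumerated set and the counting argument *)

Definition enumerated (a : nat -> bool) : set nat := [set k | exists s, enum_by a s k].

Lemma string_code_inj : injective string_code.
Proof.
elim=> [|b s IH] [|b' s'] //= e.
have eb : b = b' by move: e; case: b; case: b' => //=; lia.
by congr cons => //; apply: IH; move: e; rewrite eb; lia.
Qed.

Lemma string_code_lt s : (string_code s).+1 < 2 ^ (size s).+1.
Proof. elim: s => //= b s; rewrite [2 ^ _.+2]expnS; case: b => /=; lia. Qed.

(** It suffices to wait for the finitely many elements below [n] that ever appear; the case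
    distinction on membership is classical. *)
Lemma restriction_enumerated a n :
  exists s0, forall s, s0 <= s -> restriction (enumerated a) n = mkseq (enum_by a s) n.
Proof.
elim: n => [|n [s0 IH]]; first by exists 0.
have [[s1 s1n]|H] := pselect (enumerated a n).
  exists (maxn s0 s1) => s; rewrite geq_max => /andP[le0 le1].
  rewrite /restriction !mkseqS -/(restriction _ n) -(IH s le0).
  rewrite (leq_enum_by le1 s1n) (_ : `[< _ >] = true) //.
  by apply/asboolP; exists s1.
exists s0 => s le0; rewrite /restriction !mkseqS -/(restriction _ n) -(IH s le0).
congr rcons; transitivity false; first by apply/asboolP.
by apply/esym/negP => ns; apply: H; exists s.
Qed.

(* If all the lengths [2 * 2^i + r] failed, strategy [i] would act [2^i] times,
   and the descriptions seen at its [2^i + 1] configurations and for the [2^i]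
   lengths would be pairwise distinct, hence too many. *)
Lemma exists_complex_restriction c E a i :
  bounded_eval c E -> (forall s, a s = attention E a s) -> permanent a i ->
  exists2 r, r < 2 ^ i & forall m, m < 2 ^ i * 2 ^ i ->
    ~ eval c m (string_code (restriction (enumerated a) (2 * 2 ^ i + r))).
Proof.
move=> [hE Em EP] aE pi; set h := 2 ^ i.
have cb s j : act_count a s j <= 2 ^ j by exact: act_count_bound aE.
apply: contrapT => nex.
have ex r : r < h -> exists2 m, m < h * h &
    eval c m (string_code (restriction (enumerated a) (2 * h + r))).
  move=> rh; apply: contrapT => H; apply: nex; exists r => // m mh ev.
  by apply: H; exists m.
(* By the assumption to be refuted, every relevant prefix has a program among the first [h * h];
   from [s1] on the prefixes have settled and these programs are all seen. *)
have [s1 s1P] : exists s1, forall s, s1 <= s -> described E a s i.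
  suff /(_ h (leqnn h))[s1 s1P] : forall b, b <= h -> exists s1, forall s, s1 <= s ->
      forall r, r < b ->
      has (fun m => E s m == (string_code (mkseq (enum_by a s) (2 * h + r))).+1)
        (iota 0 (h * h)).
    by exists s1 => s /s1P H; apply/allP => r; rewrite mem_iota; exact: H.
  elim=> [|b IH] bh; first by exists 0.
  have [s1 s1P] := IH (ltnW bh).
  have [s2 s2P] := restriction_enumerated a (2 * h + b).
  have [m mh /EP[s3 s3P]] := ex b bh.
  exists (maxn s1 (maxn s2 s3)) => s; rewrite !geq_max => /and3P[l1 l2 l3] r.
  rewrite ltnS leq_eqVlt => /orP[/eqP ->|]; last exact: s1P.
  apply/hasP; exists m; first by rewrite mem_iota.
  by rewrite (Em _ _ _ _ l3 s3P) -(s2P _ l2).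
have [s0 s0P] := stabilizes (fun s t => @leq_act_count a s t i) (fun s => cb s i).
(* Were the count to stop short of [h], strategy [i] would act at its late stage [t] and raise it
   after it has stabilised. *)
have full : act_count a s0 i = h.
  apply/eqP; rewrite eqn_leq cb leqNgt; apply/negP => lt.
  pose t := pair_code i (maxn i (maxn s0 s1)).
  have : maxn i (maxn s0 s1) <= t by exact: leq_pair_code2.
  rewrite !geq_max => /and3P[it l0 l1].
  have ti : unpair1 t = i by rewrite pair_codeK1.
  have at_ : a t.
    rewrite aE /attention ti; apply/and3P; split; [|by rewrite s0P|exact: s1P].
    apply/allP => u _; apply/negP => /and3P[iu ui au].
    by have := pi u iu ui; rewrite au.
  by have := s0P t.+1 (leqW l0); rewrite act_countS s0P // ti eqxx at_ /=; lia.
(* For [j < h] this is the stage of an action, where attention includes [described]; for [j = h] a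
   late stage serves. *)
have stage (j : 'I_h.+1) : exists s, act_count a s i = j /\ described E a s i.
  have := ltn_ord j; rewrite ltnS leq_eqVlt => /orP[/eqP ->|].
    exists (maxn s0 s1); split; last by rewrite s1P ?leq_maxr.
    by rewrite s0P ?leq_maxl.
  rewrite -[X in _ < X]full => /exists_act_count[t [tj ti]]; rewrite aE => /and3P[_ _].
  by rewrite ti; exists t.
have [sg sgP] := choice stage.
have prog (p : 'I_h.+1 * 'I_h) : exists m : 'I_(h * h),
    E (sg p.1) m = (string_code (mkseq (enum_by a (sg p.1)) (2 * h + p.2))).+1.
  have [_ /allP/(_ (p.2 : nat))] := sgP p.1; rewrite mem_iota => /(_ (ltn_ord _)).
  by case/hasP => m; rewrite mem_iota => mh /eqP e; exists (Ordinal mh).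
have [f fP] := choice prog.
(* There are [(h + 1) * h] pairs but only [h * h] programs. *)
suff /leq_card : injective f.
  have : 0 < h by rewrite expn_gt0.
  by rewrite card_prod !card_ord; nia.
move=> p q fpq.
have := fP p; have := fP q; rewrite fpq => ep eq_.
have {ep eq_} : mkseq (enum_by a (sg p.1)) (2 * h + p.2)
    = mkseq (enum_by a (sg q.1)) (2 * h + q.2).
  apply: string_code_inj; apply: (eval_functional (c := c) (x := f q));
    by apply/EP; eexists; eassumption.
move=> e; have := congr1 size e; rewrite !size_mkseq => /addnI er.
(* Both prefixes contain the whole interval of strategy [i], from which the count is read off. *)
have same j : j < h -> (j < act_count a (sg p.1) i) = (j < act_count a (sg q.1) i).
  move=> jh; rewrite -!enum_byE //.
  have l2 (r : nat) : 2 ^ i + j < 2 * h + r by rewrite /h; lia.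
  by have := congr1 (nth false ^~ (2 ^ i + j)) e; rewrite !nth_mkseq.
rewrite (sgP p.1).1 (sgP q.1).1 in same.
apply/eqP; rewrite -pair_eqE /pair_eq; apply/andP; split; apply/eqP/val_inj => //=.
have := ltn_ord p.1; have := ltn_ord q.1.
case: (ltngtP (p.1 : nat) q.1) => // lt; rewrite !ltnS => l1 l2.
  by have := same _ (leq_trans lt l1); rewrite ltnn lt.
by have := same _ (leq_trans lt l2); rewrite ltnn lt.
Qed.

(** * From the counting argument to Kummer complexity *)

Lemma unbounded_infinite_set (P : set nat) :
  (forall N, exists2 n, N <= n & P n) -> infinite_set P.
Proof.
move=> H /finite_seqP[s Ps]; have [n sn] := H (\max_(x <- s) x).+1.
rewrite Ps /= => ns.
by have := @leq_bigmax_seq _ s xpredT id n ns isT; rewrite leqNgt sn.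
Qed.

(** The identity is computable, so an optimal machine describes every string and the default of
    [xget] is not reached. *)
Lemma plain_complexity_attained U x : optimal_machine U ->
  exists2 p, size p = plain_complexity U x & describes U p x.
Proof.
move=> hU; have [V VP] := computable_id; have [c /(_ x x (VP _))[q qx _]] := hU V.
suff /(xgetPex 0)[] : exists k, [set k : nat |
    (exists2 p, size p = k & describes U p x) /\
    (forall p, describes U p x -> (k <= size p)%N)]%classic k by [].
have [k /asboolP[p pk px] kmin] := ex_minnP (ex_intro
  (fun k => `[< exists2 p, size p = k & describes U p x >]) (size q)
  (asboolT (ex_intro2 _ _ q erefl qx))).
by exists k; split; [exists p|move=> r rx; apply: kmin; apply/asboolP; exists r].
Qed.

(** The construction runs against the single machine [c], whereas [kummer_complex] concerns every
    optimal [U]; a description for [U] becomes one for [c] at the cost of a constant [e]. *)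
Lemma kummer_complex_enumerated c E a :
  (forall U, optimal_machine U -> optimal_machine c) ->
  bounded_eval c E -> (forall s, a s = attention E a s) ->
  kummer_complex (enumerated a).
Proof.
(* The 4 is the gap between [2 * (i + 2)], twice the binary length of [2 * 2 ^ i + r], and the lower
   bound [2 * i]. *)
move=> copt cE aE U hU; have [e eP] := copt U hU U; exists (e + 4).
apply: unbounded_infinite_set => N.
have [i Ni pi] := permanent_unbounded N aE.
have [r rh rP] := exists_complex_restriction cE aE pi.
exists (2 * 2 ^ i + r) => /=.
  by rewrite (leq_trans Ni) // (leq_trans (ltnW (ltn_expl i (ltnSn 1)))) //; lia.
have [p <- /eP[q qx qp]] :=
  plain_complexity_attained (restriction (enumerated a) (2 * 2 ^ i + r)) hU.
have -> : binary_length (2 * 2 ^ i + r) = i.+2.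
  by congr _.+1; apply: trunc_log_eq => //; rewrite !expnS; lia.
suff : 2 * i <= size q by lia.
rewrite leqNgt; apply/negP => lt; apply: (rP (string_code q)) qx.
rewrite -expnD addnn -mul2n.
apply: leq_trans (ltnW (string_code_lt q)) _.
by rewrite leq_exp2l.
Qed.

(** * Regaining approximation *)

Local Open Scope classical_set_scope.
Local Open Scope ring_scope.

(** Stage [n] sums [n.+1] digits, so that the omitted tail is at most [2 ^- n.+1], strictly below
    the required [2 ^- n]. *)
Definition approximation (a : nat -> bool) (n : nat) : rat :=
  \sum_(k < n.+1) (enum_by a n k)%:R * 2 ^- k.+1.

Lemma computable_approximation (a : nat -> bool) :
  computable_fun (fun t => a t) -> computable_rat_seq (approximation a).
Proof.
move=> ha; have hid := computable_id.
exists (fun=> 0%N), (fun n => \sum_(k < n.+1) enum_by a n k * 2 ^ (n - k))%N,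
  (fun n => 2 ^ n.+1)%N; split.
- exact: computable_cst.
- apply: (computable_sum (F := fun n k => enum_by a n k * 2 ^ (n - k))%N);
    last exact: computable_succ.
  have h1 := computable_unpair1 hid; have h2 := computable_unpair2 hid.
  apply: computable_mul; last by apply: computable_exp2; exact: computable_sub.
  apply: (computable_enum_by (a := fun=> a)) => //.
  exact: (computable_comp ha).
- by apply: computable_exp2; exact: computable_succ.
- by move=> n; rewrite expn_gt0.
move=> n; rewrite expr0 mul1r natr_sum mulr_suml; apply: eq_bigr => k _.
rewrite natrM -mulrA; congr (_ * _); rewrite !natrX.
have kn : (k <= n)%N by rewrite -ltnS.
have -> : 2 ^+ n.+1 = 2 ^+ (n - k) * 2 ^+ k.+1 :> rat.
  by rewrite -exprD addnS subnK.
by rewrite invfM mulrA divff ?mul1r // expf_neq0.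
Qed.

Lemma ratr_approximation (R : realType) a n : ratr (approximation a n) =
  \sum_(k < n.+1) (enum_by a n k)%:R * 2 ^- k.+1 :> R.
Proof.
rewrite rmorph_sum; apply: eq_bigr => k _.
by rewrite rmorphM /= ratr_nat fmorphV rmorphXn /= ratr_nat.
Qed.

Lemma nondecreasing_approximation a : nondecreasing_seq (approximation a).
Proof.
apply/nondecreasing_seqP => n; rewrite /approximation [leRHS]big_ord_recr /=.
apply: ler_wpDr; first by rewrite mulr_ge0 // invr_ge0 exprn_ge0.
apply: ler_sum => k _; rewrite ler_wpM2r ?invr_ge0 ?exprn_ge0 // ler_nat.
by case e: (enum_by a n k) => //; rewrite (leq_enum_by (leqnSn n) e).
Qed.

(** The geometric sum from [m] to [n] is exactly [2 ^- m - 2 ^- n]; keeping the second term makes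
    the induction on [n] work. *)
Lemma series_indic_le (R : realType) (A : set nat) m n : (m <= n)%N ->
  series (fun k => \1_A k * 2 ^- k.+1 : R) n
    <= series (fun k => \1_A k * 2 ^- k.+1) m + 2 ^- m - 2 ^- n.
Proof.
elim: n => [|n IH]; first by rewrite leqn0 => /eqP ->; rewrite addrK.
rewrite leq_eqVlt => /orP[/eqP ->|/IH H]; first by rewrite addrK.
rewrite seriesSr; apply: (le_trans (lerD H (_ : _ <= 2 ^- n.+1))).
  rewrite indicE; case: (_ \in _); rewrite ?mul1r ?mul0r //.
have -> : 2 ^- n = 2 ^- n.+1 + 2 ^- n.+1 :> R.
  by rewrite exprS invfM; lra.
lra.
Qed.

Lemma nondecreasing_series_indic (R : realType) (A : set nat) :
  nondecreasing_seq (series (fun k => \1_A k * 2 ^- k.+1 : R)).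
Proof.
apply/nondecreasing_seqP => n; rewrite seriesSr lerDl.
by rewrite mulr_ge0 // ?indicE ?ler0n // invr_ge0 exprn_ge0.
Qed.

Lemma cvg_series_indic (R : realType) (A : set nat) :
  cvgn (series (fun k => \1_A k * 2 ^- k.+1 : R)).
Proof.
apply: nondecreasing_is_cvgn; first exact: nondecreasing_series_indic.
exists 1 => _ [n _ <-]; have := @series_indic_le R A _ _ (leq0n n).
move=> /le_trans; apply.
rewrite /series /= big_geq // add0r expr0 invr1 gerBl.
by rewrite invr_ge0 exprn_ge0.
Qed.

Lemma series_le_set_real (R : realType) (A : set nat) n :
  series (fun k => \1_A k * 2 ^- k.+1) n <= set_real R A.
Proof.
apply: nondecreasing_cvgn_le; last exact: cvg_series_indic.
exact: nondecreasing_series_indic.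
Qed.

Lemma set_real_le_series (R : realType) (A : set nat) n :
  set_real R A <= series (fun k => \1_A k * 2 ^- k.+1) n + 2 ^- n.
Proof.
apply: limr_le; first exact: cvg_series_indic.
exists n => // m /= nm; apply: (le_trans (@series_indic_le R A _ _ nm)).
by rewrite gerBl invr_ge0 exprn_ge0.
Qed.

Lemma approximation_le_set_real (R : realType) a n :
  ratr (approximation a n) <= set_real R (enumerated a).
Proof.
rewrite ratr_approximation; apply: (le_trans _ (@series_le_set_real R _ n.+1)).
rewrite /series /= big_mkord; apply: ler_sum => k _.
rewrite ler_wpM2r ?invr_ge0 ?exprn_ge0 // indicE ler_nat.
by case e: (enum_by a n k) => //; rewrite mem_set //; exists n.
Qed.

(** Since [i < 2 ^ i], permanence makes the digits up to [i] final at stage [i]; only the tail after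
    them is missing. *)
Lemma set_real_le_approximation (R : realType) a i : permanent a i ->
  set_real R (enumerated a) <= ratr (approximation a i) + 2 ^- i.+1.
Proof.
move=> pi; apply: (le_trans (@set_real_le_series R _ i.+1)); rewrite lerD2r.
rewrite ratr_approximation /series /= big_mkord; apply: ler_sum => k _.
rewrite ler_wpM2r ?invr_ge0 ?exprn_ge0 // indicE ler_nat.
have ki : (k < 2 ^ i)%N by rewrite (leq_ltn_trans _ (ltn_expl i (ltnSn 1))) // -ltnS.
case: (boolP (_ \in _)) => // /set_mem[s ks].
by rewrite -(enum_by_permanent pi ki (leq_maxr s i)) (leq_enum_by (leq_maxl s i) ks).
Qed.

Lemma regainingly_approximable_enumerated (R : realType) (a : nat -> bool) :
  computable_fun (fun t => a t) ->
  (forall N, exists2 i, (N <= i)%N & permanent a i) ->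
  regainingly_approximable_set R (enumerated a).
Proof.
move=> ha pa; have hid := computable_id; split.
  apply: (@comp_enumerable_exists (fun k s => enum_by a s k)).
  apply: (computable_enum_by (a := fun=> a));
    first exact: (computable_comp ha (computable_unpair2 hid)).
    exact: computable_unpair2.
  exact: computable_unpair1.
exists (approximation a); split.
- exact: computable_approximation.
- exact: nondecreasing_approximation.
- apply/cvgrPdist_lt => e e0.
  have [N eN] : exists N, 2 ^- N < e.
    exists (Num.truncn e^-1).+1; rewrite invf_plt ?posrE ?exprn_gt0 //.
    apply: (lt_trans (truncnS_gt _)).
    by rewrite -natrX ltr_nat ltn_expl.
  (* By monotonicity the error at a permanent stage bounds the error at every later stage. *)
  have [i Ni pi] := pa N; exists i => // n /= lin.
  rewrite ger0_norm ?subr_ge0 ?approximation_le_set_real //.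
  apply: le_lt_trans eN; rewrite lerBlDr.
  apply: (le_trans (@set_real_le_approximation R _ _ pi)).
  rewrite addrC lerD //; last by rewrite ler_rat nondecreasing_approximation.
  by rewrite lef_pV2 ?posrE ?exprn_gt0 // ler_eXn2l ?ltr1n // leqW.
apply: unbounded_infinite_set => N; have [i Ni pi] := pa N; exists i => //=.
rewrite ltrBlDr addrC; apply: (le_lt_trans (@set_real_le_approximation R _ _ pi)).
by rewrite ltrD2l ltf_pV2 ?posrE ?exprn_gt0 // ltr_eXn2l ?ltr1n.
Qed.

Theorem theorem7p1 (R : realType) :
  exists A : set nat, regainingly_approximable_set R A /\ kummer_complex A.
Proof.
(* Some [c] is optimal as soon as any machine is; if none is, the premise is contradictory and
   [Zero] serves as a placeholder. *)
have [c cP] : exists c, forall U, optimal_machine U -> optimal_machine c.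
  have [[c cP]|H] := pselect (exists c, optimal_machine c); first by exists c.
  by exists Zero => U hU; case: H; exists U.
have [E cE] := bounded_eval_exists c; exists (enumerated (action E)); split.
  apply: regainingly_approximable_enumerated; last first.
    by move=> N; exact: permanent_unbounded (actionE E).
  by apply: computable_action; case: cE.
exact: kummer_complex_enumerated cP cE (actionE E).
Qed.
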